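(* Let $X$ and $Y$ be topological spaces and suppose that $X$ is regular. Let $\mathbf{K}(X)$ and $\mathbf{K}(Y)$ be the spaces of non-empty compact subsets of $X$ and of $Y$, each endowed with the Vietoris topology, and let $\mathrm{map}(X,Y)$ and $\mathrm{map}(\mathbf{K}(X),\mathbf{K}(Y))$ be the sets of continuous maps, each endowed with the compact-open topology. Then the map $$\phi\colon \mathrm{map}(X,Y)\longrightarrow \mathrm{map}(\mathbf{K}(X),\mathbf{K}(Y)),\qquad \phi(f)(K)=f(K)=\{f(x)\mid x\in K\},$$ is continuous.
   Context: For a topological space $X$, $\mathbf{K}(X)$ denotes the set of non-empty compact subsets of $X$, endowed with the Vietoris topology, i.e. the topology with subbasis the sets $$\langle U_i\rangle=\{K\in\mathbf{K}(X)\mid K\subset\bigcup_i U_i,\ K\cap U_i\neq\emptyset\ \text{for all } i\},$$ where $\{U_i\}$ ranges over finite collections of open subsets of $X$. For topological spaces $A,B$, $\mathrm{map}(A,B)$ denotes the set of all continuous maps from $A$ to $B$, endowed with the compact-open topology, i.e. the topology with subbasis the sets $$W(C:U)=\{f\colon A\to B \text{ continuous}\mid f(C)\subset U\},$$ where $C\subset A$ is compact and $U\subset B$ is open. *)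

(* Defs.v *)
From HB Require Import structures.
From mathcomp Require Import all_boot all_order all_algebra finmap.
From mathcomp Require Import all_classical topology.

Set Implicit Arguments.
Unset Strict Implicit.
Unset Printing Implicit Defensive.

Local Open Scope classical_set_scope.

(* compact carries no separation or closedness assumption *)
Record hyperspace (X : topologicalType) := Hyperspace {
  hset :> set X;
  hset_compact : compact hset;
  hset_neq0 : hset !=set0
}.

Lemma hyperspace_eqP (X : topologicalType) (K L : hyperspace X) :
  hset K = hset L -> K = L.
Proof.
case: K L => [K cK K0] [L cL L0] /= KL; move: cK K0; rewrite KL => cK K0.
by congr Hyperspace; exact: Prop_irrelevance.
Qed.

HB.instance Definition _ (X : topologicalType) := gen_eqMixin (hyperspace X).
HB.instance Definition _ (X : topologicalType) :=
  gen_choiceMixin (hyperspace X).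

Definition vietoris_set (X : topologicalType) (U : set (set X)) :
    set (hyperspace X) :=
  [set K | hset K `<=` \bigcup_(A in U) A /\
           forall A, U A -> hset K `&` A !=set0].

Definition finite_open_family (X : topologicalType) : set (set (set X)) :=
  [set U | finite_set U /\ forall A, U A -> open A].

(* The subbasis is the family of vietoris_set U for U in finite_open_family. *)
HB.instance Definition _ (X : topologicalType) :=
  isSubBaseTopological.Build (hyperspace X)
    (@finite_open_family X) (@vietoris_set X).

Lemma vietoris_set_open (X : topologicalType) (U : set (set X)) :
  finite_open_family U -> open (vietoris_set U).
Proof.
move=> fU; exists [set vietoris_set U]; last by rewrite bigcup_set1.
move=> _ ->; exists [fset U]%fset; last by rewrite set_fset1 bigcap_set1.
by move=> V /fset1P ->; exact: mem_set.
Qed.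

Section image_map.
Variables (X Y : topologicalType) (f : continuousType X Y).

Lemma himage_compact (K : hyperspace X) : compact (f @` hset K).
Proof.
apply: continuous_compact; last exact: hset_compact.
by apply: continuous_subspaceT; exact: cts_fun.
Qed.

Lemma himage_neq0 (K : hyperspace X) : (f @` hset K) !=set0.
Proof. by have [x Kx] := hset_neq0 K; exists (f x), x. Qed.

Definition himage (K : hyperspace X) : hyperspace Y :=
  Hyperspace (himage_compact (K := K)) (himage_neq0 K).

Lemma himage_preimage (U : set (set Y)) :
  himage @^-1` vietoris_set U =
  vietoris_set [set f @^-1` A | A in U].
Proof.
apply/seteqP; split=> K /= [KU KA]; split.
- move=> x Kx; have [|A UA Afx] := KU (f x); first by exists x.
  by exists (f @^-1` A) => //; exists A.
- move=> _ [A UA <-]; have [_ [[x Kx <-] Afx]] := KA _ UA.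
  by exists x.
- move=> _ [x Kx <-]; have [_ [A UA <-] Afx] := KU x Kx.
  by exists A.
- move=> A UA; have [|x [Kx Afx]] := KA (f @^-1` A); first by exists A.
  by exists (f x); split => //; exists x.
Qed.

Lemma himage_continuous : continuous himage.
Proof.
apply/continuousP => _ [D DI <-]; rewrite preimage_bigcup.
apply: bigcup_open => A /DI [F FD <-]; rewrite preimage_bigcap.
rewrite openE => K FK; apply: filter_bigI => U FU; apply: open_nbhs_nbhs.
split; last exact: FK.
have /set_mem [finU oU] := FD _ FU; rewrite himage_preimage; apply: vietoris_set_open; split.
  exact: finite_image.
move=> _ [B UB <-]; apply: open_comp; last exact: oU.
by move=> x _; exact: cts_fun.
Qed.

HB.instance Definition _ :=
  isContinuous.Build (hyperspace X) (hyperspace Y) himage himage_continuous.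

End image_map.

Definition hyperspace_map (X Y : topologicalType) (f : continuousType X Y) :
    continuousType (hyperspace X) (hyperspace Y) :=
  himage f.

(* Main.v *)
Require Import Defs.
From HB Require Import structures.
From mathcomp Require Import all_boot all_order all_algebra finmap.
From mathcomp Require Import all_classical topology.

(* continuousType A B carries the compact-open topology *)
Import ArrowAsCompactOpen.

Local Open Scope classical_set_scope.

(** By definition of the compact-open topology, it is enough to take a compact
    set KK of compact subsets of X and an open O containing all f(K), K in KK,
    and to show that g(K) lies in O for all g near f and all K in KK at once.

    The union L of the members of KK is compact (compact_hyperspace_bigcup), and
    only members of KK are ever tested, so all evaluations take place inside L.
    Regularity of X makes evaluation jointly continuous there, although it need
    not be so on X: if f(x) is in U, pick a neighbourhood V of x whose closure
    is sent into U by f. The intersection of L and the closure of V is compact,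
    hence every g near f sends it into U (near_eval_within_compact).

    The two halves of a Vietoris condition, being covered by a family of open
    sets and meeting each of them, then hold at g(K') for K' near K and g near f
    (near_himage_vietoris): the first by a tube-lemma argument over K
    (near_hyperspace_cover), the second by following a single point of K
    (near_hyperspace_witness). Compactness of KK makes the neighbourhood of f
    independent of K. *)

Lemma near_hyperspace_subset (X : topologicalType) (U : set X)
    (K : hyperspace X) :
  open U -> hset K `<=` U -> \forall K' \near K, hset K' `<=` U.
Proof.
move=> oU KU; have /open_nbhs_nbhs : open_nbhs K (vietoris_set [set U]).
  split; last first.
    split; first by rewrite bigcup_set1.
    by move=> _ ->; have [x Kx] := hset_neq0 K; exists x; split=> //; exact: KU.
  by apply: vietoris_set_open; split; [exact: finite_set1|move=> _ ->].
by apply: filterS => K' []; rewrite bigcup_set1.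
Qed.

Lemma near_hyperspace_meets (X : topologicalType) (U : set X)
    (K : hyperspace X) :
  open U -> hset K `&` U !=set0 -> \forall K' \near K, hset K' `&` U !=set0.
Proof.
move=> oU KU; have /open_nbhs_nbhs : open_nbhs K (vietoris_set [set U; setT]).
  split; last first.
    (* setT removes the covering condition, leaving only that K' meets U. *)
    split; first by move=> x _; exists setT => //; right.
    by move=> _ [->//|->]; rewrite setIT; exact: hset_neq0.
  apply: vietoris_set_open; split; first exact: finite_set2.
  by move=> _ [->//|->]; exact: openT.
by apply: filterS => K' [_]; apply; left.
Qed.

(** The tube lemma, read in the hyperspace: a property holding near each point of
    K holds on a whole neighbourhood of K, which contains all K' near K. *)
Lemma near_hyperspace_cover (X : topologicalType) (I : Type)
    (F : set_system I) (P : I -> set X) (K : hyperspace X) : Filter F ->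
  (forall x, hset K x -> \forall x' \near x & i \near F, P i x') ->
  \forall K' \near K & i \near F, hset K' `<=` P i.
Proof.
move=> FF cover; have [F0|NF0] := pselect (F set0).
  (* powerset_filter_from F needs F proper; if F contains the empty set, the
     conclusion holds vacuously on it. *)
  by exists (setT, set0) => [|[? ?] []//]; split=> //; exact: filterT.
have {NF0} PF : ProperFilter F by split.
(* Covering K with members A of F in place of indices i gives one A, hence one
   neighbourhood of K, valid for all i in A simultaneously. *)
have : \forall A \near powerset_filter_from F,
    hset K `<=` [set x | nbhs x (\bigcap_(i in A) P i)].
  apply: (iffLR (compact_near_coveringP _) (@hset_compact _ K)) => x Kx.
  have [[V B] /= [Vx FB] VBP] := cover x Kx.
  exists (interior V, [set A | A `<=` B]).
    split=> /=; first by apply: open_nbhs_nbhs; split => //; exact: open_interior.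
    exact: small_set_sub.
  move=> [y A] /= [Vy AB]; apply: filterS Vy => z Vz i Ai.
  by apply: (VBP (z, i)); split=> //; exact: AB.
case=> M [MF Msub [A MA]] /(_ A MA) KA.
exists ([set K' | hset K' `<=` interior (\bigcap_(i in A) P i)], A).
  split; last exact: MF.
  by apply: near_hyperspace_subset => //; exact: open_interior.
by move=> [K' i] /= [K'P Ai] y /K'P /interior_subset; apply.
Qed.

Lemma near_hyperspace_witness (X : topologicalType) (I : Type)
    (F : set_system I) (P : I -> set X) (K : hyperspace X) (x : X) :
  hset K x -> (\forall x' \near x & i \near F, P i x') ->
  \forall K' \near K & i \near F, hset K' `&` P i !=set0.
Proof.
move=> Kx [[V B] /= [Vx FB] VBP].
exists ([set K' | hset K' `&` interior V !=set0], B).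
  split=> //; apply: near_hyperspace_meets; first exact: open_interior.
  by exists x.
move=> [K' i] /= [[y [K'y /interior_subset Vy]] Bi].
by exists y; split=> //; apply: (VBP (y, i)).
Qed.

(** A property holding near every point of the union holds uniformly on a
    neighbourhood of each member K by the tube lemma, and compactness of KK
    makes this uniform over all members. *)
Lemma compact_hyperspace_bigcup (X : topologicalType)
    (KK : set (hyperspace X)) :
  compact KK -> compact (\bigcup_(K in KK) hset K).
Proof.
move=> cKK; apply/compact_near_coveringP => I F P FF cover.
have : \forall i \near F, KK `<=` [set K | hset K `<=` P i].
  apply: (iffLR (compact_near_coveringP _) cKK) => K KKK.
  by apply: near_hyperspace_cover => x Kx; apply: cover; exists K.
by apply: filterS => i KP x [K /KP]; apply.
Qed.

(** Restricting x' to the compact set L replaces local compactness of X, under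
    which evaluation is continuous everywhere: the closed neighbourhood of x given
    by regularity meets L in a compact set. *)
Lemma near_eval_within_compact (X Y : topologicalType) (L : set X)
    (U : set Y) (f : continuousType X Y) (x : X) :
  regular_space X -> compact L -> open U -> U (f x) ->
  \forall x' \near x & g \near f, L x' -> U ((g : continuousType X Y) x').
Proof.
move=> regX cL oU Ufx.
have [V Vx VU] : filter_from (nbhs x) closure (f @^-1` U).
  by apply: regX; apply: (@cts_fun _ _ f x); exact: open_nbhs_nbhs.
exists (V, [set g : continuousType X Y | g @` (L `&` closure V) `<=` U]).
  split=> //=; have fU : nbhs (f : X -> Y) [set g | g @` (L `&` closure V) `<=` U].
    apply: open_nbhs_nbhs; split; last by move=> _ [y [_ /VU Uy] <-].
    apply: compact_open_open => //.
    by apply: compact_closedI => //; exact: closed_closure.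
  exact: (@initial_continuous (continuousType X Y) (X -> Y) id f _ fU).
move=> [y g] /= [Vy gU] Ly; apply: gU; exists y => //.
by split=> //; exact: subset_closure.
Qed.

(** The members K' of a compact set of the hyperspace all lie in its compact
    union; L stands for that union. *)
Lemma near_himage_vietoris (X Y : topologicalType) (L : set X)
    (U : set (set Y)) (f : continuousType X Y) (K : hyperspace X) :
  regular_space X -> compact L -> finite_open_family U ->
  vietoris_set U (himage f K) ->
  \forall K' \near K & g \near f,
    hset K' `<=` L -> vietoris_set U (himage g K').
Proof.
move=> regX cL [finU oU] [fKU fKA].
have oUU : open (\bigcup_(A in U) A) by exact: bigcup_open.
have subU : \forall K' \near K & g \near f,
    hset K' `<=` [set x | L x -> (\bigcup_(A in U) A) ((g : continuousType X Y) x)].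
  apply: (@near_hyperspace_cover X _ (nbhs f)
    (fun g => [set x | L x -> (\bigcup_(A in U) A) (g x)])) => x Kx.
  by apply: near_eval_within_compact => //; apply: fKU; exists x.
have meetU A : U A -> \forall K' \near K & g \near f,
    hset K' `&` [set x | L x -> A ((g : continuousType X Y) x)] !=set0.
  move=> UA; have [_ [[x Kx <-] Afx]] := fKA A UA.
  apply: (@near_hyperspace_witness X _ (nbhs f)
    (fun g => [set x | L x -> A (g x)]) _ _ Kx).
  by apply: near_eval_within_compact => //; exact: oU.
have meetsU : \forall K' \near K & g \near f,
    forall A, U A -> hset K' `&` [set x | L x -> A ((g : continuousType X Y) x)] !=set0.
  have -> : U = [set` fset_set U] by rewrite fset_setK.
  apply: (@filter_bigI _ _ (fset_set U)
    (fun A => [set Kg : hyperspace X * continuousType X Y |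
       hset Kg.1 `&` [set x | L x -> A (Kg.2 x)] !=set0])) => A.
  by rewrite in_fset_set // => /set_mem; exact: meetU.
apply: filterS2 subU meetsU => -[K' g] /= sub meets K'L; split.
  by move=> _ [x K'x <-]; apply: sub => //; exact: K'L.
move=> A /meets [x [K'x Agx]]; exists (g x).
by split; [exists x|apply/Agx/K'L].
Qed.

Theorem mainTheorem1 (X Y : topologicalType) (hX : regular_space X) :
  continuous (@hyperspace_map X Y :
    continuousType X Y -> continuousType (hyperspace X) (hyperspace Y)).
Proof.
apply: continuous_comp_initial => f; apply/compact_open_cvgP.
  by apply: fmap_filter; exact: nbhs_filter.
move=> KK O cKK oO fKO.
have cL := compact_hyperspace_bigcup _ _ cKK.
suff : \forall g \near f, KK `<=` [set K | O (himage g K)].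
  by apply: filterS => g gO _ [K KKK <-]; exact: gO.
have /near_covering_withinP ncKK := iffLR (compact_near_coveringP KK) cKK.
apply: (ncKK _ (nbhs f) (fun g K => O (himage g K))) => K KKK.
(* O contains a finite intersection of Vietoris sets that contains f(K). *)
have [D DI DO] := oO; have := fKO _ (imageP _ KKK); rewrite -DO => -[A DA Af].
have [N NU NA] := DI _ DA.
suff : \forall K' \near K & g \near f, KK K' ->
    (\bigcap_(U in [set` N]) vietoris_set U) (himage g K').
  apply: filterS => -[K' g] /= /[apply]; rewrite NA.
  by exists A.
apply: filter_bigI_within => U UN.
have fU : finite_open_family U by exact/set_mem/NU.
apply: filterS (near_himage_vietoris _ _ _ _ f K hX cL fU _) => [[K' g] /= Ug KK'|].
  by apply: Ug => x K'x; exists K'.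
by move: Af; rewrite -NA; exact.
Qed.
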